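(* Let $n\ge 1$, let $B\subseteq \mathcal{FB}_n$ be a class of free $n$-strand braids, and let $p$ be a parity for braids from $B$. Then the map $\beta\mapsto[\beta]_p$ is a well-defined map from the set of free braids for which $p$ is defined (i.e. from $B$) to the group $\mathcal{F}_n$; in other words, if $\beta$ and $\beta'$ are braid-words representing braids from $B$ and $\beta$ and $\beta'$ are equal as elements of $\mathcal{FB}_n$, then $[\beta]_p$ and $[\beta']_p$ are equal as elements of $\mathcal{F}_n$.
   Context: **Groups.** $\mathcal{F}_n$ is the group generated by $\zeta_1,\dots,\zeta_{n-1},\tau_1,\dots,\tau_{n-1}$ subject to the relations: (1) $\tau_i^2=1$, $\zeta_i^2=1$ for $i=1,\dots,n-1$ (second Reidemeister moves); (2) $\tau_i\zeta_i=\zeta_i\tau_i$ for $i=1,\dots,n-1$ (virtualization); (3) $\zeta_i\zeta_j=\zeta_j\zeta_i$, $\zeta_i\tau_j=\tau_j\zeta_i$, $\tau_i\tau_j=\tau_j\tau_i$ for $|i-j|\ge 2$ (far commutativity); (4) $\tau_i\tau_{i+1}\tau_i=\tau_{i+1}\tau_i\tau_{i+1}$ for $i=1,\dots,n-2$; (5) $\tau_i\tau_{i+1}\zeta_i=\zeta_{i+1}\tau_i\tau_{i+1}$ for $i=1,\dots,n-2$. The free $n$-strand braid group $\mathcal{FB}_n$ is the quotient of $\mathcal{F}_n$ by the relations $\zeta_i\zeta_{i+1}\zeta_i=\zeta_{i+1}\zeta_i\zeta_{i+1}$, $i=1,\dots,n-2$ (third Reidemeister moves). A free $n$-strand braid is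 an element of $\mathcal{FB}_n$. A braid-word is a finite word in the letters $\zeta_i,\tau_i$ ($1\le i\le n-1$). Occurrences of letters $\zeta_i$ in a word are called classical crossings. Words are read from top to bottom, so ''upper'' means the first and ''lower'' the last letter. **Parity.** Let $B$ be a set of free $n$-strand braids. A parity for braids from $B$ is a way of associating elements of $\mathbb{Z}_2$ (even $=0$, odd $=1$) with all classical crossings of all braid-words representing braids from $B$ such that: 1. If two braid-words $ApC$ and $AqC$ are obtained from one another by applying a defining relation $p\to q$ of $\mathcal{FB}_n$, then the parities of all crossings belonging to $A$ or to $C$ do not change. 2. For $\zeta_i\zeta_j\to\zeta_j\zeta_i$, $|i-j|\ge2$, the parity of $\zeta_i$ on the left-hand side equals that of $\zeta_i$ on the right-hand side, and likewise for $\zeta_j$. 3. For $\zeta_i\tau_j\to\tau_j\zeta_i$, $|i-j|\ge 2$, the parity of $\zeta_i$ does not change. 4. For $\zeta_i^2\to 1$, both letters $\zeta_i$ on the left have the same parity. 5. For $\zeta_i\zeta_{i+1}\zeta_i\to\zeta_{i+1}\zeta_i\zeta_{i+1}$: (a) the number of odd crossings among the three on the left is even; (b) the parity of the upper $\zeta_i$ on the left equals that of the lower $\zeta_{i+1}$ on the right; (c) the parity of the middle $\zeta_{i+1}$ on the left equals that of the middle $\zeta_i$ on the right; (d) the parity of the lower $\zeta_i$ on the left equals that of the upper $\zeta_{i+1}$ on the right. 6. For $\tau_i\tau_{i+1}\zeta_i\to\zeta_{i+1}\tau_i\tau_{i+1}$, the parity of $\zeta_i$ on the left equals that of $\zeta_{i+1}$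 on the right. 7. For $\zeta_i\tau_i\to\tau_i\zeta_i$, the parity of $\zeta_i$ does not change. **One-term parity bracket.** For a braid-word $\beta$ representing a braid from $B$, $[\beta]_p$ is the $n$-strand braid-word obtained from $\beta$ by removing all letters $\zeta_i$ that are even with respect to $p$ (all letters $\tau_i$ are kept). *)

(* Defs.v *)
From HB Require Import structures.
From mathcomp Require Import all_boot all_algebra.
From mathcomp Require Import boolp classical_sets.

Set Implicit Arguments.
Unset Strict Implicit.
Unset Printing Implicit Defensive.

Local Open Scope quotient_scope.

(* The group with generators X and relations u = v whenever R u v, where the
   relations are between positive words.  It is the quotient of the words in
   the letters x = (x, false) and x^-1 = (x, true) by the congruence generated
   by R and free cancellation. *)
Section Presentation.
Variables (X : choiceType) (R : seq X -> seq X -> Prop).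

Definition gword := seq (X * bool).
Definition positive (u : seq X) : gword := [seq (x, false) | x <- u].
Definition gword_inv (w : gword) : gword := rev [seq (a.1, ~~ a.2) | a <- w].

Inductive presEq : gword -> gword -> Prop :=
| presEq_refl w : presEq w w
| presEq_sym v w : presEq v w -> presEq w v
| presEq_trans u v w : presEq u v -> presEq v w -> presEq u w
| presEq_cancel A x b C : presEq (A ++ [:: (x, b); (x, ~~ b)] ++ C) (A ++ C)
| presEq_rel A u v C :
    R u v -> presEq (A ++ positive u ++ C) (A ++ positive v ++ C).

Definition presEqb (u v : gword) : bool := `[< presEq u v >].

Fact presEqb_refl : reflexive presEqb.
Proof. by move=> w; apply/asboolP; apply: presEq_refl. Qed.

Fact presEqb_sym : symmetric presEqb.
Proof. by move=> v w; apply/asboolP/asboolP; apply: presEq_sym. Qed.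

Fact presEqb_trans : transitive presEqb.
Proof.
by move=> v u w /asboolP uv /asboolP vw; apply/asboolP; apply: presEq_trans vw.
Qed.

Canonical presEq_equiv := EquivRel presEqb presEqb_refl presEqb_sym presEqb_trans.

Definition presented := {eq_quot presEq_equiv}.
HB.instance Definition _ := Choice.on presented.
HB.instance Definition _ := EqQuotient.on presented.

Definition gword_class (w : gword) : presented := \pi_presented w.

Lemma gword_classP u v : gword_class u = gword_class v <-> presEq u v.
Proof.
split=> [/(@eqquotP _ presEq_equiv presented)/asboolP //|uv].
by apply/(@eqquotP _ presEq_equiv presented)/asboolP.
Qed.

Lemma gword_class_repr (x : presented) : gword_class (repr x) = x.
Proof. exact: reprK. Qed.

Lemma presEq_ctx A C u v : presEq u v -> presEq (A ++ u ++ C) (A ++ v ++ C).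
Proof.
elim=> {u v} [w|v w _|u v w _ IH1 _ IH2|A' x b C'|A' u v C' Ruv].
- exact: presEq_refl.
- exact: presEq_sym.
- exact: presEq_trans IH1 IH2.
- by have := presEq_cancel (A ++ A') x b (C' ++ C); rewrite -!catA.
- by have := presEq_rel (A ++ A') (C' ++ C) Ruv; rewrite -!catA.
Qed.

Lemma presEq_cat u u' v v' : presEq u u' -> presEq v v' -> presEq (u ++ v) (u' ++ v').
Proof.
move=> /(presEq_ctx [::] v) uu' /(presEq_ctx u' [::]); rewrite !cats0.
exact: presEq_trans.
Qed.

Lemma gword_invK : involutive gword_inv.
Proof.
move=> w; rewrite /gword_inv map_rev revK -map_comp map_id_in // => -[x b] _ /=.
by rewrite negbK.
Qed.

Lemma presEq_mulV w : presEq (w ++ gword_inv w) [::].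
Proof.
elim: w => [|[x b] w IH]; first exact: presEq_refl.
rewrite /gword_inv map_cons rev_cons -cats1 -/(gword_inv w) /=.
have := presEq_ctx [:: (x, b)] [:: (x, ~~ b)] IH; rewrite -!catA /=.
by move/presEq_trans; apply; apply: (presEq_cancel [::] x b [::]).
Qed.

Lemma presEq_Vmul w : presEq (gword_inv w ++ w) [::].
Proof. by rewrite -{2}[w]gword_invK; apply: presEq_mulV. Qed.

Lemma presEq_inv u v : presEq u v -> presEq (gword_inv u) (gword_inv v).
Proof.
move=> uv; apply: presEq_trans (presEq_ctx [::] (gword_inv v) (presEq_Vmul u)).
rewrite -catA /= -{1}[gword_inv u]cats0; apply: presEq_cat (presEq_refl _) _.
apply: presEq_sym; apply: presEq_trans (presEq_mulV v).
by apply: presEq_cat (presEq_refl _).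
Qed.

Definition presented_one : presented := gword_class [::].
Definition presented_mul (x y : presented) : presented :=
  gword_class (repr x ++ repr y).
Definition presented_inv (x : presented) : presented :=
  gword_class (gword_inv (repr x)).

Lemma repr_gword_class w : presEq (repr (gword_class w)) w.
Proof. by apply/gword_classP; rewrite gword_class_repr. Qed.

Lemma presented_mulE u v :
  presented_mul (gword_class u) (gword_class v) = gword_class (u ++ v).
Proof. by apply/gword_classP/presEq_cat; apply: repr_gword_class. Qed.

Lemma presented_invE u :
  presented_inv (gword_class u) = gword_class (gword_inv u).
Proof. by apply/gword_classP/presEq_inv; apply: repr_gword_class. Qed.

Fact presented_mulA : associative presented_mul.
Proof.
move=> x y z; rewrite -[x]gword_class_repr -[y]gword_class_repr.
by rewrite -[z]gword_class_repr !presented_mulE catA.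
Qed.

Fact presented_mul1 : left_id presented_one presented_mul.
Proof. by move=> x; rewrite -[x]gword_class_repr presented_mulE. Qed.

Fact presented_mul1r : right_id presented_one presented_mul.
Proof. by move=> x; rewrite -[x]gword_class_repr presented_mulE cats0. Qed.

Fact presented_mulV : left_inverse presented_one presented_inv presented_mul.
Proof.
move=> x; rewrite -[x]gword_class_repr presented_invE presented_mulE.
exact/gword_classP/presEq_Vmul.
Qed.

Fact presented_mulrV : right_inverse presented_one presented_inv presented_mul.
Proof.
move=> x; rewrite -[x]gword_class_repr presented_invE presented_mulE.
exact/gword_classP/presEq_mulV.
Qed.

HB.instance Definition _ := isGroup.Build presented
  presented_mulA presented_mul1 presented_mul1r presented_mulV presented_mulrV.

Definition generator (x : X) : presented := gword_class [:: (x, false)].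

Definition word_eval (u : seq X) : presented := (\prod_(x <- u) generator x)%g.

Lemma word_evalE u : word_eval u = gword_class (positive u).
Proof.
rewrite /word_eval; elim: u => [|x u IH]; first by rewrite big_nil.
by rewrite big_cons IH; apply: presented_mulE.
Qed.

End Presentation.

(* Indices are 0-based: i : 'I_n.-1 stands for the index i + 1 in 1, ..., n-1. *)
Inductive letter (n : nat) : Type :=
| zeta of 'I_n.-1
| tau of 'I_n.-1.

Section LetterChoice.
Variable n : nat.

Definition letter_code (a : letter n) : 'I_n.-1 + 'I_n.-1 :=
  match a with zeta i => inl i | tau i => inr i end.
Definition letter_decode (c : 'I_n.-1 + 'I_n.-1) : letter n :=
  match c with inl i => zeta i | inr i => tau i end.
Lemma letter_codeK : cancel letter_code letter_decode.
Proof. by case. Qed.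

HB.instance Definition _ := Choice.copy (letter n) (can_type letter_codeK).

End LetterChoice.

Definition word (n : nat) := seq (letter n).

Definition far (i j : nat) : bool := (i + 2 <= j) || (j + 2 <= i).

Section Braids.
Variable n : nat.
Implicit Types (i j : 'I_n.-1) (A C u v w : word n).

Inductive F_rel : word n -> word n -> Prop :=
| F_tau2 i : F_rel [:: tau i; tau i] [::]
| F_zeta2 i : F_rel [:: zeta i; zeta i] [::]
| F_virt i : F_rel [:: tau i; zeta i] [:: zeta i; tau i]
| F_far_zz i j : far i j -> F_rel [:: zeta i; zeta j] [:: zeta j; zeta i]
| F_far_zt i j : far i j -> F_rel [:: zeta i; tau j] [:: tau j; zeta i]
| F_far_tt i j : far i j -> F_rel [:: tau i; tau j] [:: tau j; tau i]
| F_ttt i j : j = i.+1 :> nat ->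
    F_rel [:: tau i; tau j; tau i] [:: tau j; tau i; tau j]
| F_ttz i j : j = i.+1 :> nat ->
    F_rel [:: tau i; tau j; zeta i] [:: zeta j; tau i; tau j].

Inductive FB_rel : word n -> word n -> Prop :=
| FB_F u v : F_rel u v -> FB_rel u v
| FB_zzz i j : j = i.+1 :> nat ->
    FB_rel [:: zeta i; zeta j; zeta i] [:: zeta j; zeta i; zeta j].

Definition F_group := presented F_rel.
Definition FB_group := presented FB_rel.

Definition F_elt w : F_group := word_eval F_rel w.
Definition braid w : FB_group := word_eval FB_rel w.

(* Letters of a word are numbered from 0, from top to bottom. *)
Definition is_crossing w (k : nat) : bool :=
  if onth w k is Some (zeta _) then true else false.

(* [p w k] is the parity of the [k]-th letter of [w].  It is meaningful only when
   [w] represents a braid from [B] and this letter is a classical crossing: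
   [parity] does not constrain the other values, and for such words [bracket]
   does not read them.  The value 1 means odd. *)
Section Parity.
Variables (B : set FB_group) (p : word n -> nat -> 'Z_2).

(* Parity, in the word A u C, of the k-th letter of u. *)
Definition parity_in A u C (k : nat) : 'Z_2 := p (A ++ u ++ C) (size A + k).

Definition odd_number (s : seq 'Z_2) : nat := count (pred1 1%R) s.

Record parity : Prop := Parity {
  parity_above A C u v k : FB_rel u v ->
    B (braid (A ++ u ++ C)) -> is_crossing A k ->
    p (A ++ u ++ C) k = p (A ++ v ++ C) k;
  parity_below A C u v k : FB_rel u v ->
    B (braid (A ++ u ++ C)) -> is_crossing C k ->
    p (A ++ u ++ C) (size A + size u + k) = p (A ++ v ++ C) (size A + size v + k);
  parity_far_zz A C i j : far i j ->
    let l := [:: zeta i; zeta j] in let r := [:: zeta j; zeta i] in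
    B (braid (A ++ l ++ C)) ->
    parity_in A l C 0 = parity_in A r C 1 /\
    parity_in A l C 1 = parity_in A r C 0;
  parity_far_zt A C i j : far i j ->
    let l := [:: zeta i; tau j] in let r := [:: tau j; zeta i] in
    B (braid (A ++ l ++ C)) -> parity_in A l C 0 = parity_in A r C 1;
  parity_zeta2 A C i :
    let l := [:: zeta i; zeta i] in
    B (braid (A ++ l ++ C)) -> parity_in A l C 0 = parity_in A l C 1;
  parity_zzz A C i j : j = i.+1 :> nat ->
    let l := [:: zeta i; zeta j; zeta i] in
    let r := [:: zeta j; zeta i; zeta j] in
    B (braid (A ++ l ++ C)) ->
    [/\ ~~ odd (odd_number [seq parity_in A l C k | k <- [:: 0; 1; 2]]),
        parity_in A l C 0 = parity_in A r C 2,
        parity_in A l C 1 = parity_in A r C 1 &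
        parity_in A l C 2 = parity_in A r C 0];
  parity_ttz A C i j : j = i.+1 :> nat ->
    let l := [:: tau i; tau j; zeta i] in
    let r := [:: zeta j; tau i; tau j] in
    B (braid (A ++ l ++ C)) -> parity_in A l C 2 = parity_in A r C 0;
  parity_virt A C i :
    let l := [:: zeta i; tau i] in let r := [:: tau i; zeta i] in
    B (braid (A ++ l ++ C)) -> parity_in A l C 0 = parity_in A r C 1
}.

Definition bracket w : word n :=
  mask [seq ~~ (is_crossing w k && (p w k == 0%R)) | k <- iota 0 (size w)] w.

End Parity.
End Braids.

(* Main.v *)
Require Import Defs.
From mathcomp Require Import all_boot all_algebra.
From mathcomp Require Import boolp classical_sets.

(* Every generator is an involution, so the signs of the letters can be
   forgotten, and it suffices to compare the brackets of two words related by a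
   single defining relation.  The parity axioms make the letters outside the
   relation survive on one side exactly when they survive on the other.  A third
   Reidemeister move has zero or two odd crossings: the two sides keep the same
   word, or zeta_i zeta_i and zeta_(i+1) zeta_(i+1), both trivial.  Any other
   relation stays a relation of F_n or becomes an identity of words. *)

Section Kept.
Context {n : nat}.
Implicit Types (u v w : word n) (f g : nat -> 'Z_2).

(** The parities are a free function [f], not [p w], so that the bracket can be computed factor by
    factor with shifted positions. *)
Definition kept f w : word n :=
  mask [seq ~~ (is_crossing w k && (f k == 0%R)) | k <- iota 0 (size w)] w.

Lemma bracketE (p : word n -> nat -> 'Z_2) w : bracket p w = kept (p w) w.
Proof. by []. Qed.

Lemma kept_zeta f i w :
  kept f (zeta i :: w) =
  if f 0 == 0%R then kept (f \o succn) w else zeta i :: kept (f \o succn) w.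
Proof. by rewrite /kept /= (iotaDl 1 0) -map_comp; case: eqP. Qed.

Lemma kept_tau f i w : kept f (tau i :: w) = tau i :: kept (f \o succn) w.
Proof. by rewrite /kept /= (iotaDl 1 0) -map_comp. Qed.

Lemma kept_nil f : kept f [::] = [::].
Proof. by []. Qed.

Definition keptE := (kept_zeta, kept_tau, kept_nil).

Lemma kept_cat f u v :
  kept f (u ++ v) = kept f u ++ kept (fun k => f (size u + k)) v.
Proof.
elim: u f => [//|[i|i] u IH] f; rewrite cat_cons !keptE IH.
  by case: ifP.
by [].
Qed.

Lemma eq_kept f g w :
  (forall k, is_crossing w k -> f k = g k) -> kept f w = kept g w.
Proof.
move=> fg; congr mask; apply: eq_map => k.
by case: (boolP (is_crossing w k)) => // /fg ->.
Qed.

End Kept.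

Lemma unzip1_positive (X : choiceType) (u : seq X) : unzip1 (positive u) = u.
Proof. by rewrite /unzip1 -map_comp map_id. Qed.

Lemma gword_class_unzip1 {X : choiceType} {R : seq X -> seq X -> Prop} :
  (forall x, R [:: x; x] [::]) ->
  forall g, gword_class R g = word_eval R (unzip1 g).
Proof.
move=> RV g; rewrite word_evalE; apply/gword_classP.
elim: g => [|[x b] g IH]; first exact: presEq_refl.
apply: (@presEq_cat _ R [:: (x, b)] [:: (x, false)]) IH.
case: b; last exact: presEq_refl.
(* This is the chain $x^{-1} = x^{-1} x x = x$. *)
apply: presEq_trans (presEq_cancel R [::] x true [:: (x, false)]).
exact/presEq_sym/(presEq_rel [:: (x, true)] [::] (RV x)).
Qed.

Lemma word_eval_rel {X : choiceType} {R : seq X -> seq X -> Prop} {u v} A C :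
  R u v -> word_eval R (A ++ u ++ C) = word_eval R (A ++ v ++ C).
Proof.
move=> Ruv; rewrite !word_evalE /positive !map_cat.
exact/gword_classP/presEq_rel.
Qed.

Lemma word_eval_rel0 {X : choiceType} {R : seq X -> seq X -> Prop} {u v} :
  R u v -> word_eval R u = word_eval R v.
Proof. by move/(word_eval_rel [::] [::]); rewrite !cats0. Qed.

Lemma FB_rel_sqr {n} (x : letter n) : FB_rel [:: x; x] [::].
Proof. by apply: FB_F; case: x => i; [apply: F_zeta2|apply: F_tau2]. Qed.

Lemma Z2_cases (x : 'Z_2) : x = 0%R \/ x = 1%R.
Proof. by case: x => -[|[|//]] Hx; [left|right]; apply: val_inj. Qed.

Section Invariance.
Context {n : nat} {B : set (FB_group n)} {p : word n -> nat -> 'Z_2}.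
Hypothesis hp : parity B p.

Lemma F_elt_kept_rel A u v C : FB_rel u v -> B (braid (A ++ u ++ C)) ->
  F_elt (kept (parity_in p A u C) u) = F_elt (kept (parity_in p A v C) v).
Proof.
(* [F_virt] is oriented opposite to [parity_virt], so that case needs the word containing [v] to
   represent a braid from [B]. *)
move=> uv Bu; have Bv := Bu.
rewrite /braid (word_eval_rel A C uv) in Bv.
case: uv Bu Bv => [{}u {}v|i j ij] => [[]|].
- by move=> i _ _; rewrite !keptE; apply/word_eval_rel0/F_tau2.
- move=> i Bu _; have /= e := parity_zeta2 hp Bu; rewrite !keptE /= -e.
  by case: eqP => // _; apply/word_eval_rel0/F_zeta2.
- move=> i _ Bv; have /= e := parity_virt hp Bv; rewrite !keptE /= -e.
  by case: eqP => // _; apply/word_eval_rel0/F_virt.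
- move=> i j ij Bu _; have /= [e0 e1] := parity_far_zz hp ij Bu.
  rewrite !keptE /= -e0 -e1.
  by do 2![case: eqP => _ //]; apply/word_eval_rel0/F_far_zz.
- move=> i j ij Bu _; have /= e := parity_far_zt hp ij Bu; rewrite !keptE /= -e.
  by case: eqP => // _; apply/word_eval_rel0/F_far_zt.
- by move=> i j ij _ _; rewrite !keptE; apply/word_eval_rel0/F_far_tt.
- by move=> i j ij _ _; rewrite !keptE; apply/word_eval_rel0/F_ttt.
- move=> i j ij Bu _; have /= e := parity_ttz hp ij Bu; rewrite !keptE /= -e.
  by case: eqP => // _; apply/word_eval_rel0/F_ttz.
- move=> Bu _; have /= [even_odd e0 e1 e2] := parity_zzz hp ij Bu.
  move: even_odd; rewrite !keptE /= -e0 -e1 -e2.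
  move: (parity_in p A _ C) => q.
  (* Evenness excludes four of the eight triples. If all three are even, or the middle one and one
     other are odd, both sides are the same word. Only odd, even, odd remains, with two squares to
     compare. *)
  case: (Z2_cases (q 0)) (Z2_cases (q 1)) (Z2_cases (q 2)) => -> [] -> [] -> //= _.
  by rewrite /F_elt !(word_eval_rel0 (F_zeta2 _)).
Qed.

Lemma F_elt_cat (u v : word n) : F_elt (u ++ v) = (F_elt u * F_elt v)%g.
Proof. exact: big_cat. Qed.

Lemma F_elt_bracket_rel A u v C : FB_rel u v -> B (braid (A ++ u ++ C)) ->
  F_elt (bracket p (A ++ u ++ C)) = F_elt (bracket p (A ++ v ++ C)).
Proof.
move=> uv Bu; rewrite !bracketE !kept_cat !F_elt_cat.
congr (F_elt _ * (_ * F_elt _))%g.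
- by apply: eq_kept => k; apply: (parity_above hp).
(* The shift by [size A] coming from [kept_cat] is the one built into [parity_in]. *)
- exact: F_elt_kept_rel.
- by apply: eq_kept => k kC; rewrite !addnA; apply: (parity_below hp).
Qed.

(** A derivation may pass through words with inverse letters, where [p] is undefined; dropping signs
    by [unzip1] gives a braid-word at each stage. Membership in [B] passes along because the class
    is constant. *)
Lemma F_elt_bracket_presEq g g' : presEq (@FB_rel n) g g' ->
  B (gword_class _ g) ->
  F_elt (bracket p (unzip1 g)) = F_elt (bracket p (unzip1 g')).
Proof.
elim=> {g g'} [//|v w vw IH|u v w uv IHuv _ IHvw|A x b C|A u v C uv] Bg.
- by move/gword_classP: vw IH => -> /(_ Bg).
- by rewrite IHuv // IHvw //; move/gword_classP: uv => <-.
(* Without signs, a free cancellation is the relation $x x = 1$. *)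
- move: Bg; rewrite (gword_class_unzip1 FB_rel_sqr) /unzip1 !map_cat /=.
  exact: F_elt_bracket_rel (FB_rel_sqr x).
- move: Bg; rewrite (gword_class_unzip1 FB_rel_sqr) /unzip1 !map_cat.
  by rewrite -!/(unzip1 _) !unzip1_positive; apply: F_elt_bracket_rel.
Qed.

Lemma F_elt_bracket_braid w w' : B (braid w) -> braid w = braid w' ->
  F_elt (bracket p w) = F_elt (bracket p w').
Proof.
rewrite /braid !word_evalE => Bw /gword_classP ww'.
by have := F_elt_bracket_presEq _ _ ww' Bw; rewrite !unzip1_positive.
Qed.

End Invariance.

Theorem theorem1 (n : nat) (hn : 1 <= n) (B : set (FB_group n))
    (p : word n -> nat -> 'Z_2) (hp : parity B p) :
  (forall w w' : word n, B (braid w) -> B (braid w') -> braid w = braid w' ->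
     F_elt (bracket p w) = F_elt (bracket p w')) /\
  (exists f : {b : FB_group n | B b} -> F_group n,
     forall (w : word n) (Bw : B (braid w)),
       f (exist _ (braid w) Bw) = F_elt (bracket p w)).
Proof.
split=> [w w' Bw _|]; first exact: (F_elt_bracket_braid hp).
(* The chosen representative may contain inverse letters; stripped of signs, it still represents
   [b]. *)
exists (fun b => F_elt (bracket p (unzip1 (repr (sval b))))) => w Bw /=.
apply/esym; apply: (F_elt_bracket_braid hp) => //.
rewrite {2}/braid -(gword_class_unzip1 FB_rel_sqr).
exact/esym/gword_class_repr.
Qed.
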